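(* Let $p$ be a prime, let $G$ be a non-trivial finite $p$-group and let $k$ be a field of characteristic $p$. There are no non-trivial maps in $\mathrm{stmod}(kG)$ that are trivial in Tate cohomology (that is, every ghost between finite-dimensional $kG$-modules is zero in $\mathrm{stmod}(kG)$) if and only if $G$ is isomorphic to either $C_2$ or $C_3$. In other words, the generating hypothesis holds for $kG$ if and only if $G$ is either $C_2$ or $C_3$.
   Context: All modules are left modules. $C_n$ denotes the cyclic group of order $n$. For a finite group $G$ and a field $k$ whose characteristic divides $|G|$, the stable module category $\mathrm{StMod}(kG)$ has as objects the $kG$-modules, and its morphism spaces are $\underline{\mathrm{Hom}}_{kG}(M,N)$, the $k$-vector space of $kG$-module homomorphisms $M\to N$ modulo those that factor through a projective $kG$-module. $\mathrm{stmod}(kG)$ is the category defined in the same way using only finite-dimensional $kG$-modules. $\Omega M$ denotes the kernel of a surjection from a projective module onto $M$; $\Omega$ is a self-equivalence of the stable category (the desuspension), so $\Omega^i$ is defined for all $i\in\mathbb{Z}$. Tate cohomology is $\widehat{H}^i(G,M)\cong\underline{\mathrm{Hom}}_{kG}(\Omega^i k,M)$, $i\in\mathbb{Z}$, where $k$ is the trivial $kG$-module. A map $\phi\colon M\to N$ is ''trivial'' if it is zero in the stable category, i.e. factors through a projective. It is a ''ghost'' (trivial in Tate cohomology) if the induced map $\underline{\mathrm{Hom}}_{kG}(\Omega^i k,M)\to\underline{\mathrm{Hom}}_{kG}(\Omega^i k,N)$ is zero for every $i\in\mathbb{Z}$. For a finite $p$-group $G$ and a field $k$ of characteristic $p$,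 the generating hypothesis (GH) for $kG$ is the statement that every ghost between finite-dimensional $kG$-modules is trivial in $\mathrm{stmod}(kG)$. *)

(* Defs.v *)
From HB Require Import structures.
From mathcomp Require Import all_boot all_order all_algebra all_fingroup.

Set Implicit Arguments.
Unset Strict Implicit.
Unset Printing Implicit Defensive.

Import GRing.Theory.
Local Open Scope ring_scope.

(* The element a of kG stands for \sum_g a(g) g.  The type is an alias of      *)
(* {ffun gT -> k} because the library's ring structure on the latter is        *)
(* pointwise.                                                                  *)
Definition group_algebra (k : fieldType) (gT : finGroupType) := {ffun gT -> k}.

Section GroupAlgebra.
Variables (k : fieldType) (gT : finGroupType).
Local Notation kG := (group_algebra k gT).
Implicit Types a b c : kG.

HB.instance Definition _ := GRing.Zmodule.copy kG {ffun gT -> k}.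

Definition ga_scale (x : k) a : kG := [ffun g => x * a g].

Fact ga_scaleA x y a : ga_scale x (ga_scale y a) = ga_scale (x * y) a.
Proof. by apply/ffunP=> g; rewrite !ffunE mulrA. Qed.

Fact ga_scale1 : left_id 1 ga_scale.
Proof. by move=> a; apply/ffunP=> g; rewrite ffunE mul1r. Qed.

Fact ga_scaleDr : right_distributive ga_scale +%R.
Proof. by move=> x a b; apply/ffunP=> g; rewrite !ffunE mulrDr. Qed.

Fact ga_scaleDl a : {morph ga_scale^~ a : x y / x + y}.
Proof. by move=> x y; apply/ffunP=> g; rewrite !ffunE mulrDl. Qed.

HB.instance Definition _ := GRing.Zmodule_isLmodule.Build k kG
  ga_scaleA ga_scale1 ga_scaleDr ga_scaleDl.

Definition ga_one : kG := [ffun g => (g == 1%g)%:R].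
Definition ga_mul a b : kG := [ffun g => \sum_h a h * b (h^-1 * g)%g].

Fact ga_mulA : associative ga_mul.
Proof.
move=> a b c; apply/ffunP=> g; rewrite !ffunE.
under eq_bigr => h _ do rewrite ffunE big_distrr /=.
under [RHS]eq_bigr => h _ do rewrite ffunE big_distrl /=.
rewrite [RHS]exchange_big /=; apply: eq_bigr => h _.
rewrite [RHS](reindex_inj (mulgI h)) /=; apply: eq_bigr => x _.
by rewrite mulKg invMg !mulrA mulgA.
Qed.

Fact ga_mul1 : left_id ga_one ga_mul.
Proof.
move=> a; apply/ffunP=> g; rewrite !ffunE (bigD1 1%g) //= big1 => [|h /negPf hN].
  by rewrite ffunE eqxx mul1r invg1 mul1g addr0.
by rewrite ffunE hN mul0r.
Qed.

Fact ga_mulr1 : right_id ga_one ga_mul.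
Proof.
move=> a; apply/ffunP=> g; rewrite !ffunE (bigD1 g) //= big1 => [|h hN].
  by rewrite ffunE mulVg eqxx mulr1 addr0.
by rewrite ffunE -eq_mulVg1 (negPf hN) mulr0.
Qed.

Fact ga_mulDl : left_distributive ga_mul +%R.
Proof.
move=> a b c; apply/ffunP=> g; rewrite !ffunE -big_split /=.
by apply: eq_bigr => h _; rewrite ffunE mulrDl.
Qed.

Fact ga_mulDr : right_distributive ga_mul +%R.
Proof.
move=> a b c; apply/ffunP=> g; rewrite !ffunE -big_split /=.
by apply: eq_bigr => h _; rewrite ffunE mulrDr.
Qed.

Fact ga_one_neq0 : ga_one != 0.
Proof.
by apply/eqP => /ffunP/(_ 1%g)/eqP; rewrite !ffunE eqxx oner_eq0.
Qed.

HB.instance Definition _ := GRing.Zmodule_isNzRing.Build kG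
  ga_mulA ga_mul1 ga_mulr1 ga_mulDl ga_mulDr ga_one_neq0.

Fact ga_scaleAl (x : k) a b : x *: (a * b) = x *: a * b.
Proof.
apply/ffunP=> g; rewrite !ffunE big_distrr /=.
by apply: eq_bigr => h _; rewrite ffunE mulrA.
Qed.

HB.instance Definition _ := GRing.Lmodule_isLalgebra.Build k kG ga_scaleAl.

Fact ga_scaleAr (x : k) a b : x *: (a * b) = a * (x *: b).
Proof.
apply/ffunP=> g; rewrite !ffunE big_distrr /=.
by apply: eq_bigr => h _; rewrite ffunE mulrCA.
Qed.

HB.instance Definition _ := GRing.Lalgebra_isAlgebra.Build k kG ga_scaleAr.

Definition augmentation a : k := \sum_g a g.

Fact augmentation1 : augmentation 1 = 1.
Proof.
rewrite /augmentation (bigD1 1%g) //= big1 => [|g /negPf gN].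
  by rewrite ffunE eqxx addr0.
by rewrite ffunE gN.
Qed.

Fact augmentationD a b : augmentation (a + b) = augmentation a + augmentation b.
Proof.
by rewrite /augmentation -big_split /=; apply: eq_bigr => g _; rewrite ffunE.
Qed.

Fact augmentationM a b : augmentation (a * b) = augmentation a * augmentation b.
Proof.
rewrite /augmentation; under eq_bigr => g _ do rewrite ffunE.
rewrite exchange_big big_distrl /=; apply: eq_bigr => h _.
rewrite (reindex_inj (mulgI h)) big_distrr /=.
by apply: eq_bigr => g _; rewrite mulKg.
Qed.

End GroupAlgebra.

(* The trivial kG-module k, on which every g in G acts as the identity. *)
Definition trivial_module (k : fieldType) (gT : finGroupType) : Type := k.

Section TrivialModule.
Variables (k : fieldType) (gT : finGroupType).
Local Notation kG := (group_algebra k gT).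
Local Notation k1 := (trivial_module k gT).

HB.instance Definition _ := GRing.Zmodule.copy k1 k.

Definition triv_scale (a : kG) (x : k1) : k1 := augmentation a * (x : k).

Fact triv_scaleA a b x : triv_scale a (triv_scale b x) = triv_scale (a * b) x.
Proof. by rewrite /triv_scale augmentationM mulrA. Qed.

Fact triv_scale1 : left_id 1 triv_scale.
Proof. by move=> x; rewrite /triv_scale augmentation1 mul1r. Qed.

Fact triv_scaleDr : right_distributive triv_scale +%R.
Proof. by move=> a x y; rewrite /triv_scale mulrDr. Qed.

Fact triv_scaleDl x : {morph triv_scale^~ x : a b / a + b}.
Proof. by move=> a b; rewrite /triv_scale augmentationD mulrDl. Qed.

HB.instance Definition _ := GRing.Zmodule_isLmodule.Build kG k1
  triv_scaleA triv_scale1 triv_scaleDr triv_scaleDl.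

End TrivialModule.

Section Modules.
Variable R : nzRingType.
Implicit Types M N P K : lmodType R.

Definition surjective (S T : Type) (f : S -> T) := forall y, exists x, f x = y.

Definition projective P : Prop :=
  forall (M N : lmodType R) (q : {linear M -> N}) (f : {linear P -> N}),
    surjective q -> exists h : {linear P -> M}, forall x, q (h x) = f x.

Definition factors_through P M N (f : M -> N) : Prop :=
  exists (u : {linear M -> P}) (v : {linear P -> N}), forall x, f x = v (u x).

(* f is zero in StMod(R). *)
Definition stably_trivial M N (f : M -> N) : Prop :=
  exists P, projective P /\ factors_through P f.

(* M and N are isomorphic in StMod(R). *)
Definition stably_iso M N : Prop :=
  exists (f : {linear M -> N}) (g : {linear N -> M}),
    stably_trivial (fun x => g (f x) - x) /\
    stably_trivial (fun y => f (g y) - y).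

(* K is (isomorphic to) the kernel of a surjection of a projective onto M. *)
Definition is_Omega K M : Prop :=
  exists (P : lmodType R) (i : {linear K -> P}) (q : {linear P -> M}),
    [/\ projective P, injective i, surjective q &
        forall x, q x = 0 <-> exists y, i y = x].

Fixpoint is_Omega_iter (n : nat) K M : Prop :=
  if n is n'.+1 then exists L : lmodType R, is_Omega_iter n' L M /\ is_Omega K L
  else stably_iso K M.

(* K represents Omega^i M in StMod(R).  As Omega is a self-equivalence of the  *)
(* stable category, K represents Omega^(-n) M when M represents Omega^n K.     *)
Definition is_Omega_pow (i : int) K M : Prop :=
  match i with
  | Posz n => is_Omega_iter n K M
  | Negz n => is_Omega_iter n.+1 M K
  end.

End Modules.

Section GeneratingHypothesis.
Variables (k : fieldType) (gT : finGroupType).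
Local Notation kG := (group_algebra k gT).
Implicit Types M N P : lmodType kG.

(* M has a finite spanning family over k, which acts on M through c |-> c 1.  *)
Definition finite_dim M : Prop :=
  exists (n : nat) (v : 'I_n -> M), forall x : M,
    exists c : 'I_n -> k, x = \sum_(i < n) ((c i)%:A : kG) *: v i.

(* f is zero in stmod(kG). *)
Definition stmod_trivial M N (f : M -> N) : Prop :=
  exists P, [/\ finite_dim P, projective P & factors_through P f].

(* The map induced by f from the stable Hom(Omega^i k, M) to the stable        *)
(* Hom(Omega^i k, N) sends the class of h to the class of f o h.               *)
Definition ghost M N (f : {linear M -> N}) : Prop :=
  forall (i : int) (X : lmodType kG),
    is_Omega_pow i X (trivial_module k gT) ->
    forall h : {linear X -> M}, stably_trivial (fun x => f (h x)).

Definition generating_hypothesis : Prop :=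
  forall M N, finite_dim M -> finite_dim N ->
  forall f : {linear M -> N}, ghost f -> stmod_trivial f.

End GeneratingHypothesis.

Arguments generating_hypothesis k gT : clear implicits.

(* Main.v *)
From HB Require Import structures.
From mathcomp Require Import all_boot all_order all_algebra.
From mathcomp Require Import all_fingroup all_solvable.
From mathcomp Require boolp classical_sets.
Require Import Defs.

(* A map is stably trivial iff it is a trace \sum_g g phi g^-1 of a k-linear *)
(* map phi.                                                                  *)
(*   If |G| > 3, choose an abelian subgroup H of order > 3, an additive      *)
(* functional lam : H -> k with lam y = 1, and let H act on k^2 by the       *)
(* unipotent matrices with off-diagonal entry lam h.  As 1, lam and lam^2    *)
(* sum to 0 over H, every trace over H of an endomorphism of k^2 is 0, so    *)
(* y - 1 is not stably trivial on k^2.  The map induced by y - 1 on the      *)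
(* coinduced module is a non-trivial ghost: y acts as the identity on k,     *)
(* hence, by dimension shifting, y - 1 is stably trivial over H on each      *)
(* Omega^i k.                                                                *)
(*   If G = <y> has order p = 2 or 3 and t = y - 1, then kG = k[t]/t^p, and  *)
(* testing a ghost f : M -> N on k and on Omega^-1 k yields                  *)
(* f (ker t^i) <= im t^(p-i) for 0 < i < p.  This is enough to write f as a  *)
(* sum of maps of the form \sum_i t^i phi t^(p-1-i), which are traces.       *)

Set Implicit Arguments.
Unset Strict Implicit.
Unset Printing Implicit Defensive.

Import GRing.Theory.
Local Open Scope ring_scope.

(** * Complements in vector spaces *)

(** The criterion [stably_trivialP] turns the whole question into sums over the group. Coinduced
    modules are projective and every module is a quotient of one, so a map is stably trivial iff it
    is the transfer of a k-linear map, in any dimension.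

    If |G| > 3, the ghost is built over a subgroup H and coinduced to G. By [delta_trivial_Omega], y
    - 1 is stably zero over H on every Omega^i k. A map from Omega^i k to k^2 commutes with y - 1,
    so following it by y - 1 gives a stably trivial map ([affine_map_ghost]). Non-triviality
    ([affine_map_nontrivial]) rests on the vanishing over H of the sums of 1, lam and lam^2
    ([additive_functional_moments]), which fails for groups of order 2 and 3.

    If |G| = p is 2 or 3, the norm element is t^(p-1). Testing on k sends ker t into im t^(p-1)
    ([ghost_fixed]), and testing on Omega^-1 k sends ker t^(p-1) into im t ([ghost_norm_eq0]); for p
    <= 3 no other exponent occurs. Subtracting traces makes the ghost kill ker t^(p-1). It then
    factors k-linearly through t^(p-1), and this exhibits it as a trace ([ghost_is_trace2],
    [ghost_is_trace3]). *)

Section VectorSpaces.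
Variable F : fieldType.

Definition subspace (U : lmodType F) (K : U -> Prop) :=
  K 0 /\ forall c u v, K u -> K v -> K (c *: u + v).

Lemma subspaceB (U : lmodType F) (K : U -> Prop) u v :
  subspace K -> K u -> K v -> K (u - v).
Proof. by case=> _ Klin Ku Kv; rewrite addrC -scaleN1r; apply: Klin. Qed.

Lemma subspaceZ (U : lmodType F) (K : U -> Prop) c u :
  subspace K -> K u -> K (c *: u).
Proof. by case=> K0 Klin Ku; rewrite -[_ *: _]addr0; apply: Klin. Qed.

(** Zorn's lemma is needed because the modules representing Omega^i k and the projectives in
    [stably_trivial] may be infinite-dimensional. *)
Lemma subspace_compl (U : lmodType F) (K : U -> Prop) : subspace K ->
  exists A : U -> Prop, [/\ subspace A, forall u, A u -> K u -> u = 0 &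
    forall u, exists a, K a /\ A (u - a)].
Proof.
move=> sK; pose P (A : classical_sets.set U) :=
  (forall c u v, A u -> A v -> A (c *: u + v)) /\
  (forall u, A u -> K u -> u = 0).
have [|A [[Alin AK] Amax]] := @classical_sets.Zorn_bigcup U P.
  move=> C CP Ctot; split=> [c u v [X CX Xu] [Y CY Yv] | u [X CX Xu] Ku].
    have [XY|YX] := Ctot _ _ CX CY.
      by exists Y => //; apply: (CP _ CY).1 => //; apply: XY.
    by exists X => //; apply: (CP _ CX).1 => //; apply: YX.
  exact: (CP _ CX).2 Ku.
(* The empty set also satisfies [P], as the union of the empty chain must, so 0 is adjoined by
   hand. *)
pose A0 u := A u \/ u = 0.
have sA0 : subspace A0.
  split=> [|c u v Au Av]; first by right.
  have [u0|u0] := eqVneq u 0; first by rewrite u0 scaler0 add0r.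
  case: Au => [Au|/eqP]; last by rewrite (negPf u0).
  case: Av => [Av|->]; first by left; apply: Alin.
  by left; rewrite addr0 -[c](subrK 1) scalerDl scale1r; apply: Alin.
have A0K u : A0 u -> K u -> u = 0 by case=> // Au; apply: AK.
exists A0; split=> // u; apply: boolp.contrapT => noa.
(* If u lies outside K + A0, the span of A0 and u still meets K trivially, against maximality. *)
pose B : classical_sets.set U := fun w => exists c, A0 (w - c *: u).
case: (Amax B).
  split=> [w Aw|BA]; first by exists 0; rewrite scale0r subr0; left.
  apply: noa; exists 0; split; first by case: sK.
  by rewrite subr0; left; apply: BA; exists 1; rewrite scale1r subrr; right.
split=> [c v w [a Aa] [b Ab] | w [c Ac] Kw].
  exists (c * a + b); rewrite scalerDl opprD addrACA -scalerA -scalerBr.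
  by case: sA0 => _; apply.
have [c0|c0] := eqVneq c 0.
  by apply: A0K => //; move: Ac; rewrite c0 scale0r subr0.
case: noa; exists (c^-1 *: w); split; first exact: subspaceZ.
have -> : u - c^-1 *: w = (- c^-1) *: (w - c *: u).
  by rewrite scalerBr scalerA mulNr mulVf // !scaleNr scale1r opprK addrC.
exact: subspaceZ.
Qed.

Lemma subspace_proj (U : lmodType F) (K : U -> Prop) : subspace K ->
  exists pi : U -> U, [/\ linear pi, forall u, K (pi u) &
    forall u, K u -> pi u = u].
Proof.
move=> sK; have [A [sA AK dec]] := subspace_compl sK.
have [pi piP] := boolp.choice dec.
have uniq u a : K a -> A (u - a) -> pi u = a.
  move=> Ka Aa; have [Kp Ap] := piP u; apply/eqP; rewrite -subr_eq0; apply/eqP.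
  apply: AK; last exact: subspaceB.
  by have := subspaceB sA Aa Ap; rewrite opprB addrC subrKA.
exists pi; split=> [c u v|u|u Ku]; last 2 first.
- by case: (piP u).
- by apply: uniq => //; rewrite subrr; case: sA.
have [[Ku Au] [Kv Av]] := (piP u, piP v).
apply: uniq; first by case: sK => _; apply.
by rewrite opprD addrACA -scalerBr; case: sA => _; apply.
Qed.

(** Project onto the image of q, choose a preimage, and remove its component in ker q. The last
    correction makes the result independent of the choice, hence linear. *)
Lemma linear_pinv (U V : lmodType F) (q : U -> V) : linear q ->
  exists2 s : V -> U, linear s & forall u, q (s (q u)) = q u.
Proof.
move=> qlin; have q0 : q 0 = 0.
  by have := qlin (-1) 0 0; rewrite scaler0 addr0 scaleN1r addNr.
have qB u v : q (u - v) = q u - q v.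
  by rewrite -[u - v]addrC -scaleN1r qlin scaleN1r addrC.
have [|pk [pkl pkK pkid]] := @subspace_proj _ (fun u => q u = 0).
  by split=> // c u v qu qv; rewrite qlin qu qv scaler0 addr0.
have [|pv [pvl pvI pvid]] := @subspace_proj _ (fun v => exists u, q u = v).
  split=> [|c _ _ [u <-] [v <-]]; first by exists 0.
  by exists (c *: u + v); rewrite qlin.
have [g gP] := boolp.choice pvI.
have pkE u v : q u = q v -> u - pk u = v - pk v.
  move=> quv; apply/eqP; rewrite -subr_eq0 opprD addrACA -opprD.
  have /pkid <- : q (u - v) = 0 by rewrite qB quv subrr.
  by rewrite -[u - v]addrC -scaleN1r pkl scaleN1r [- _ + _]addrC subrr.
exists (fun v => g v - pk (g v)) => [c u v|u]; last first.
  by rewrite qB pkK subr0 gP pvid //; exists u.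
rewrite (pkE _ (c *: g u + g v)); last by rewrite qlin !gP pvl.
by rewrite pkl opprD addrACA -scalerBr.
Qed.

End VectorSpaces.

(** * k-linear maps and traces *)

Section GroupElements.
Variables (k : fieldType) (gT : finGroupType).
Local Notation kG := (group_algebra k gT).
Implicit Types (a b : kG) (g h x : gT).

Definition ge g : kG := [ffun x => (x == g)%:R].

Lemma ge_mulE g a x : (ge g * a) x = a (g^-1 * x)%g.
Proof.
rewrite ffunE (bigD1 g) //= ffunE eqxx mul1r big1 ?addr0 // => h /negPf hg.
by rewrite ffunE hg mul0r.
Qed.

Lemma mul_geE g a x : (a * ge g) x = a (x * g^-1)%g.
Proof.
rewrite ffunE (bigD1 (x * g^-1)%g) //= ffunE invMg invgK mulgKV eqxx mulr1.
rewrite big1 ?addr0 // => h hg; rewrite ffunE.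
case: eqP => [E|_]; last exact: mulr0.
by case/eqP: hg; rewrite -E invMg invgK mulKVg.
Qed.

Lemma ge1 : ge 1 = 1.
Proof. by []. Qed.

Lemma geM g h : ge g * ge h = ge (g * h).
Proof.
by apply/ffunP=> x; rewrite ge_mulE !ffunE -(inj_eq (mulgI g)) mulKVg.
Qed.

Lemma ga_sum a : a = \sum_g (a g)%:A * ge g.
Proof.
apply/ffunP=> x; rewrite sum_ffunE (bigD1 x) //= mulr_algl !ffunE eqxx mulr1.
rewrite big1 ?addr0 // => g /negPf gx.
by rewrite mulr_algl !ffunE eq_sym gx mulr0.
Qed.

Lemma ge_comm_scalar g (c : k) : ge g * c%:A = c%:A * ge g.
Proof. by rewrite mulr_algl mulr_algr. Qed.

Lemma augmentation_ge g : augmentation (ge g) = 1.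
Proof.
rewrite /augmentation (bigD1 g) //= ffunE eqxx big1 ?addr0 // => h /negPf hg.
by rewrite ffunE hg.
Qed.

End GroupElements.

(** An alias, so that the k-module structure does not compete with the kG-module structure on M. *)
Definition restrict_scalars (k : fieldType) (gT : finGroupType)
  (M : lmodType (group_algebra k gT)) : Type := M.

Section RestrictScalars.
Variables (k : fieldType) (gT : finGroupType).
Local Notation kG := (group_algebra k gT).
Variable M : lmodType kG.
Local Notation res := (restrict_scalars M).

HB.instance Definition _ := GRing.Zmodule.copy res M.

Definition res_scale (c : k) (m : res) : res := c%:A *: (m : M).

Fact res_scaleA c d m : res_scale c (res_scale d m) = res_scale (c * d) m.
Proof. by rewrite /res_scale scalerA mulr_algl scalerA. Qed.

Fact res_scale1 : left_id 1 res_scale.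
Proof. by move=> m; rewrite /res_scale !scale1r. Qed.

Fact res_scaleDr : right_distributive res_scale +%R.
Proof. by move=> c m n; rewrite /res_scale scalerDr. Qed.

Fact res_scaleDl m : {morph res_scale^~ m : c d / c + d}.
Proof. by move=> c d; rewrite /res_scale !scalerDl. Qed.

HB.instance Definition _ := GRing.Zmodule_isLmodule.Build k res
  res_scaleA res_scale1 res_scaleDr res_scaleDl.

End RestrictScalars.

Section KLinear.
Variables (k : fieldType) (gT : finGroupType).
Local Notation kG := (group_algebra k gT).
Local Notation ge := (@ge k gT).
Implicit Types (M N P : lmodType kG) (g : gT) (H : {set gT}).

Definition klinear M N (f : M -> N) :=
  forall (c : k) x y, f (c%:A *: x + y) = c%:A *: f x + f y.

Lemma klinear_lin M N (f : {linear M -> N}) : klinear f.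
Proof. by move=> c x y; rewrite linearP. Qed.

Lemma klinear_id M : klinear (@id M).
Proof. by []. Qed.

Lemma klinear_comp M N P (f : N -> P) (h : M -> N) :
  klinear f -> klinear h -> klinear (fun x => f (h x)).
Proof. by move=> fl hl c x y; rewrite hl fl. Qed.

Lemma klinear_act M N (f : M -> N) g :
  klinear f -> klinear (fun x => ge g *: f x).
Proof.
by move=> fl c x y; rewrite fl scalerDr !scalerA ge_comm_scalar.
Qed.

Lemma klinear_act_arg M N (f : M -> N) g :
  klinear f -> klinear (fun x => f (ge g *: x)).
Proof. by move=> fl; exact/(klinear_comp fl)/klinear_act/klinear_id. Qed.

Lemma klinearD_fun M N (f h : M -> N) :
  klinear f -> klinear h -> klinear (fun x => f x + h x).
Proof. by move=> fl hl c x y; rewrite fl hl addrACA scalerDr. Qed.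

Lemma klinearN_fun M N (f : M -> N) : klinear f -> klinear (fun x => - f x).
Proof. by move=> fl c x y; rewrite fl opprD scalerN. Qed.

Lemma klinear_sum_fun (I : Type) (r : seq I) (Q : pred I)
    M N (f : I -> M -> N) :
  (forall i, klinear (f i)) -> klinear (fun x => \sum_(i <- r | Q i) f i x).
Proof.
move=> fl c x y; rewrite scaler_sumr -big_split /=.
by apply: eq_bigr => i _; rewrite fl.
Qed.

Section Theory.
Variables (M N : lmodType kG) (f : M -> N).
Hypothesis fl : klinear f.

Lemma klinearD x y : f (x + y) = f x + f y.
Proof. by have := fl 1 x y; rewrite !scale1r. Qed.

Lemma klinear0 : f 0 = 0.
Proof. by apply: (addrI (f 0)); rewrite -klinearD !addr0. Qed.

Lemma klinearZ c x : f (c%:A *: x) = c%:A *: f x.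
Proof. by have := fl c x 0; rewrite klinear0 !addr0. Qed.

Lemma klinearN x : f (- x) = - f x.
Proof. by apply: (addrI (f x)); rewrite -klinearD !subrr klinear0. Qed.

Lemma klinearB x y : f (x - y) = f x - f y.
Proof. by rewrite klinearD klinearN. Qed.

Lemma klinear_sum (I : Type) (r : seq I) (Q : pred I) (F : I -> M) :
  f (\sum_(i <- r | Q i) F i) = \sum_(i <- r | Q i) f (F i).
Proof. exact: (big_morph f klinearD klinear0). Qed.

Lemma klinear_linear :
  (forall g x, f (ge g *: x) = ge g *: f x) -> linear f.
Proof.
move=> fg a x y; rewrite klinearD; congr (_ + _).
rewrite [a in LHS]ga_sum [a in RHS]ga_sum !scaler_suml klinear_sum.
by apply: eq_bigr => g _; rewrite -!scalerA klinearZ fg.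
Qed.

End Theory.

Lemma linear_pack M N (f : M -> N) : linear f ->
  exists h : {linear M -> N}, forall x, h x = f x.
Proof.
move=> fl; pose fL := GRing.isLinear.Build _ _ _ _ f fl.
by exists (HB.pack f fL : {linear M -> N}).
Qed.

Lemma klinear_pinv M N (q : M -> N) : klinear q ->
  exists2 s : N -> M, klinear s & forall u, q (s (q u)) = q u.
Proof.
exact: (@linear_pinv k (restrict_scalars M) (restrict_scalars N) q).
Qed.

Lemma klinear_section M N (q : M -> N) : klinear q -> surjective q ->
  exists2 s : N -> M, klinear s & forall v, q (s v) = v.
Proof.
move=> ql qs; have [s sl sq] := klinear_pinv ql.
by exists s => // v; have [u <-] := qs v.
Qed.

(** The transfer from the trivial subgroup to H on Hom_k(M, N), with G acting by conjugation. *)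
Definition trace H M N (f : M -> N) x := \sum_(u in H) ge u *: f (ge u^-1 *: x).

Definition is_trace H M N (f : M -> N) :=
  exists2 h : M -> N, klinear h & forall x, f x = trace H h x.

Lemma klinear_trace H M N (f : M -> N) : klinear f -> klinear (trace H f).
Proof.
by move=> fl; apply: klinear_sum_fun => u; apply/klinear_act/klinear_act_arg.
Qed.

Lemma trace_act (H : {group gT}) M N (f : M -> N) g x : g \in H ->
  trace H f (ge g *: x) = ge g *: trace H f x.
Proof.
move=> gH; rewrite /trace scaler_sumr (reindex_inj (mulgI g)) /=.
apply: eq_big => [u|u _]; first by rewrite groupMl.
by rewrite !scalerA !geM invMg mulgKV.
Qed.

Lemma trace_comp H M N P (f : M -> N) (v : N -> P) : klinear v ->
  (forall g x, g \in H -> v (ge g *: x) = ge g *: v x) ->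
  forall x, v (trace H f x) = trace H (fun x => v (f x)) x.
Proof.
move=> vl vg x; rewrite /trace (klinear_sum vl).
by apply: eq_bigr => g gH; rewrite vg.
Qed.

Lemma trace_comp_arg (H : {group gT}) M N P (f : N -> P) (v : M -> N) :
  (forall g x, g \in H -> v (ge g *: x) = ge g *: v x) ->
  forall x, trace H f (v x) = trace H (fun x => f (v x)) x.
Proof.
by move=> vg x; apply: eq_bigr => g gH; rewrite vg // groupV.
Qed.

Lemma is_traceB H M N (f h : M -> N) :
  is_trace H f -> is_trace H h -> is_trace H (fun x => f x - h x).
Proof.
move=> [f' fl fE] [h' hl hE]; exists (fun x => f' x - h' x).
  exact/klinearD_fun/klinearN_fun.
move=> x; rewrite fE hE -sumrB; apply: eq_bigr => u _.
by rewrite scalerBr.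
Qed.

Lemma is_traceN H M N (f : M -> N) :
  is_trace H f -> is_trace H (fun x => - f x).
Proof.
move=> [f' fl fE]; exists (fun x => - f' x); first exact: klinearN_fun.
by move=> x; rewrite fE -sumrN; apply: eq_bigr => u _; rewrite scalerN.
Qed.

(** R consists of the chosen representatives of the right cosets of K in H. Summing in an arbitrary
    group V serves both traces and moments. *)
Lemma big_cosets (K H : {group gT}) : K \subset H ->
  exists2 R : {set gT}, R \subset H & forall (V : zmodType) (F : gT -> V),
    \sum_(g in H) F g = \sum_(r in R) \sum_(u in K) F (u * r)%g.
Proof.
move=> sKH; pose R := [set r in H | repr (K :* r)%g == r]; exists R.
  by apply/subsetP => r; rewrite inE => /andP[].
move=> V F.
rewrite (partition_big (fun g => repr (K :* g)%g) (mem R)) /= => [|g gH].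
  apply: eq_bigr => r; rewrite inE => /andP[rH /eqP rr].
  rewrite (reindex_inj (mulIg r)) /=; apply: eq_bigl => u.
  apply/andP/idP => [[urH /eqP E]|uK].
    have := mem_repr_rcoset K (u * r)%g; rewrite E => /rcosetP[v vK E'].
    move/(congr1 (mulg^~ r^-1))%g: E'; rewrite mulgV -mulgA mulgK => /eqP.
    by rewrite eq_sym -eq_invg_mul => /eqP <-; rewrite groupV.
  split; first by rewrite groupM // (subsetP sKH).
  by rewrite rcosetM rcoset_id // rr.
have : repr (K :* g)%g \in (K :* g)%g by exact: mem_repr_rcoset.
move=> /[dup] /rcoset_eqP E /rcosetP[v vK E'].
by rewrite inE E eqxx andbT E' groupM // (subsetP sKH).
Qed.

(** Transitivity of the transfer: the sum over coset representatives is absorbed into the k-linear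
    map. *)
Lemma is_trace_sub (K : {group gT}) M N (f : M -> N) :
  is_trace [set: gT] f -> is_trace K f.
Proof.
move=> [h hl hE].
have [R _ RE] := big_cosets (subsetT K : K \subset [set: gT]%G).
exists (fun x => \sum_(r in R) ge r *: h (ge r^-1 *: x)) => [|x].
  by apply: klinear_sum_fun => r; apply/klinear_act/klinear_act_arg.
rewrite hE /trace RE exchange_big /=; apply: eq_bigr => u _.
rewrite scaler_sumr; apply: eq_bigr => r _.
by rewrite !scalerA !geM invMg.
Qed.

End KLinear.
Arguments trace_comp {k gT H M N P f v} _ _ _.
Arguments trace_comp_arg {k gT H M N P f v} _ _.

(** * Coinduced modules and stable triviality *)

(* Coinduction from the trivial subgroup; only the k-space W matters. *)
Definition coind (k : fieldType) (gT : finGroupType)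
  (W : lmodType (group_algebra k gT)) : Type := {ffun gT -> W}.

Section Coinduction.
Variables (k : fieldType) (gT : finGroupType).
Local Notation kG := (group_algebra k gT).
Local Notation ge := (@ge k gT).
Variable W : lmodType kG.

HB.instance Definition _ := GRing.Zmodule.copy (coind W) {ffun gT -> W}.

Definition coind_scale (a : kG) (f : coind W) : coind W :=
  [ffun x => \sum_g (a g)%:A *: f (x * g)%g].

Fact coind_scaleA a b f :
  coind_scale a (coind_scale b f) = coind_scale (a * b) f.
Proof.
apply/ffunP=> x; rewrite !ffunE.
under eq_bigr => h _.
  rewrite ffunE scaler_sumr (reindex_inj (mulgI h^-1)%g).
  over.
rewrite exchange_big /=; apply: eq_bigr => g _.
rewrite ffunE scaler_suml scaler_suml; apply: eq_bigr => h _.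
by rewrite mulgA mulgK scalerA mulr_algl scalerA.
Qed.

Fact coind_scale1 : left_id 1 coind_scale.
Proof.
move=> f; apply/ffunP=> x; rewrite ffunE (bigD1 1%g) //= big1 => [|g /negPf g1].
  by rewrite ffunE eqxx mulg1 !scale1r addr0.
by rewrite ffunE g1 !scale0r.
Qed.

Fact coind_scaleDr : right_distributive coind_scale +%R.
Proof.
move=> a f h; apply/ffunP=> x; rewrite !ffunE -big_split /=.
by apply: eq_bigr => g _; rewrite ffunE scalerDr.
Qed.

Fact coind_scaleDl f : {morph coind_scale^~ f : a b / a + b}.
Proof.
move=> a b; apply/ffunP=> x; rewrite !ffunE -big_split /=.
by apply: eq_bigr => g _; rewrite ffunE !scalerDl.
Qed.

HB.instance Definition _ := GRing.Zmodule_isLmodule.Build kG (coind W)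
  coind_scaleA coind_scale1 coind_scaleDr coind_scaleDl.

Lemma coind_geE g (f : coind W) x : (ge g *: f) x = f (x * g)%g.
Proof.
rewrite ffunE (bigD1 g) //= big1 => [|h /negPf hg].
  by rewrite ffunE eqxx !scale1r addr0.
by rewrite ffunE hg !scale0r.
Qed.

Lemma coind_scalarE (c : k) (f : coind W) x : (c%:A *: f) x = c%:A *: f x.
Proof.
rewrite ffunE (bigD1 1%g) //= big1 => [|h /negPf h1].
  by rewrite ffunE ffunE eqxx mulr1 mulg1 addr0.
by rewrite ffunE ffunE h1 mulr0 !scale0r.
Qed.

Lemma klinear_ev x : @klinear k gT (coind W) W (fun f => f x).
Proof. by move=> c f h; rewrite ffunE coind_scalarE. Qed.

(** As G is finite, coinduction is also induction: k-linear maps out of W extend to kG-maps out of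
    [coind W]. *)
Lemma linear_coindl (N : lmodType kG) (psi : W -> N) : klinear psi ->
  linear (fun f : coind W => \sum_x ge x^-1 *: psi (f x)).
Proof.
move=> pl; apply: klinear_linear => [|g f].
  apply: klinear_sum_fun => x.
  exact/klinear_act/(klinear_comp pl)/klinear_ev.
rewrite scaler_sumr (reindex_inj (mulIg g^-1)%g) /=.
apply: eq_bigr => x _; rewrite coind_geE mulgKV.
by rewrite scalerA geM invMg invgK.
Qed.

(** The other adjunction, for k-linear maps into W. *)
Lemma linear_coindr (M : lmodType kG) (phi : M -> W) : klinear phi ->
  linear (fun m => [ffun x => phi (ge x *: m)] : coind W).
Proof.
move=> pl; apply: klinear_linear => [c m n|g m]; apply/ffunP=> x.
  by rewrite [RHS]ffunE coind_scalarE !ffunE (klinear_act_arg x pl).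
by rewrite coind_geE !ffunE scalerA geM.
Qed.

Definition coind_delta (w : W) : coind W :=
  [ffun x => if x == 1%g then w else 0].

Lemma klinear_coind_delta : klinear coind_delta.
Proof.
move=> c v w; apply/ffunP=> x; rewrite [RHS]ffunE coind_scalarE !ffunE.
by case: ifP; rewrite ?scaler0 ?addr0.
Qed.

Lemma coind_sum (f : coind W) : f = \sum_x ge x^-1 *: coind_delta (f x).
Proof.
apply/ffunP=> x; rewrite sum_ffunE (bigD1 x) //= coind_geE ffunE mulgV eqxx.
rewrite big1 ?addr0 // => y yx; rewrite coind_geE ffunE -eq_mulgV1 eq_sym.
by rewrite (negPf yx).
Qed.

(** By the induction adjunction a lift over kG amounts to a lift over k, which a k-linear section of
    q provides. *)
Lemma coind_projective : projective (coind W).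
Proof.
move=> M N q f qs; have [s sl qsK] := klinear_section (klinear_lin q) qs.
have pl : klinear (fun w => s (f (coind_delta w))).
  by apply/(klinear_comp sl)/klinear_comp/klinear_coind_delta/klinear_lin.
have [h hE] := linear_pack (linear_coindl pl).
exists h => x; rewrite hE [x in RHS]coind_sum !linear_sum.
by apply: eq_bigr => g _; rewrite !linearZ_LR qsK.
Qed.

Lemma coind_finite_dim : finite_dim W -> finite_dim (coind W).
Proof.
move=> [n [v vP]].
pose w (i : 'I_#|{: gT * 'I_n}|) : coind W :=
  ge (enum_val i).1^-1 *: coind_delta (v (enum_val i).2).
exists #|{: gT * 'I_n}|, w => f.
have [c cP] := boolp.choice (fun x => vP (f x)).
exists (fun i => c (enum_val i).1 (enum_val i).2).
rewrite [LHS]coind_sum.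
under eq_bigr => x _.
  rewrite cP (klinear_sum klinear_coind_delta) scaler_sumr.
  under eq_bigr => i _ do
    rewrite (klinearZ klinear_coind_delta) scalerA ge_comm_scalar -scalerA.
  over.
rewrite pair_big /= (reindex (@enum_val _ predT)) //=.
exact/onW_bij/enum_val_bij.
Qed.

End Coinduction.

Section StableMaps.
Variables (k : fieldType) (gT : finGroupType).
Local Notation kG := (group_algebra k gT).
Local Notation ge := (@ge k gT).
Implicit Types (M N P X : lmodType kG).

Lemma trace_factors M N (f : M -> N) :
  is_trace [set: gT] f -> factors_through (coind N) f.
Proof.
move=> [h hl hE].
have [u uE] := linear_pack (linear_coindr hl).
have [v vE] := linear_pack (linear_coindl (@klinear_id _ _ N)).
exists u, v => x; rewrite vE hE /trace (reindex_inj invg_inj) /=.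
by apply: eq_big => [g|g _]; rewrite ?in_setT // uE ffunE invgK.
Qed.

(** Projectivity splits the surjection [coind P] -> P. The splitting followed by evaluation at 1 is
    a k-linear map whose trace is the identity. *)
Lemma projective_trace P : projective P -> is_trace [set: gT] (@id P).
Proof.
move=> pP; have [q qE] := linear_pack (linear_coindl (@klinear_id _ _ P)).
have [|h hP] := pP _ _ q idfun.
  move=> w; exists (coind_delta w); rewrite qE (bigD1 1%g) //= ffunE eqxx.
  rewrite invg1 ge1 scale1r big1 ?addr0 // => g /negPf g1.
  by rewrite ffunE g1 scaler0.
exists (fun m => h m 1%g) => [|x].
  exact/(klinear_comp (klinear_ev _))/klinear_lin.
rewrite -{1}[x]hP qE /trace (reindex_inj invg_inj) /=.
apply: eq_big => [g|g _]; rewrite ?in_setT //.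
by rewrite !linearZ_LR coind_geE mul1g !invgK.
Qed.

(** Higman's criterion: the identity of a projective is a trace, and traces absorb kG-maps on both
    sides. *)
Lemma stably_trivialP M N (f : M -> N) :
  stably_trivial f <-> is_trace [set: gT] f.
Proof.
split=> [[P [pP [u [v uv]]]]|fT]; last first.
  by exists (coind N); split; [exact: coind_projective | exact: trace_factors].
have [h hl hE] := projective_trace pP.
exists (fun x => v (h (u x))) => [|x].
  exact/(klinear_comp (klinear_lin v))/(klinear_comp hl)/klinear_lin.
rewrite uv [u x]hE (trace_comp_arg (H := [set: gT]%G)); last first.
  by move=> *; exact: linearZ_LR.
by rewrite trace_comp // => [|g y _]; [exact: klinear_lin | exact: linearZ_LR].
Qed.

(** The projective that realises a trace is [coind N], so for finite-dimensional N being zero in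
    stmod and in StMod agree. *)
Lemma stmod_trivialP M N (f : M -> N) : finite_dim N ->
  stmod_trivial f <-> is_trace [set: gT] f.
Proof.
move=> fN; split=> [[P [_ pP uv]]|fT]; first by apply/stably_trivialP; exists P.
exists (coind N); split; [exact: coind_finite_dim | exact: coind_projective |].
exact: trace_factors.
Qed.

End StableMaps.

(** * Central elements act trivially on the Omega^i k *)

Section CentralElements.
Variables (k : fieldType) (gT : finGroupType).
Local Notation kG := (group_algebra k gT).
Local Notation ge := (@ge k gT).
Implicit Types (M N P K L X : lmodType kG).
Variables (H : {group gT}) (y : gT).
Hypothesis yH : forall u, u \in H -> commute y u.

Lemma is_trace_compl M N P (f : M -> N) (v : N -> P) : klinear v ->
  (forall g x, g \in H -> v (ge g *: x) = ge g *: v x) ->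
  is_trace H f -> is_trace H (fun x => v (f x)).
Proof.
move=> vl vg [h hl hE]; exists (fun x => v (h x)); first exact: klinear_comp.
by move=> x; rewrite hE trace_comp.
Qed.

Lemma is_trace_compr M N P (f : N -> P) (v : M -> N) : klinear v ->
  (forall g x, g \in H -> v (ge g *: x) = ge g *: v x) ->
  is_trace H f -> is_trace H (fun x => f (v x)).
Proof.
move=> vl vg [h hl hE]; exists (fun x => h (v x)); first exact: klinear_comp.
by move=> x; rewrite hE trace_comp_arg.
Qed.

Local Notation delta m := ((ge y - 1) *: m).

Lemma delta_klinear M : klinear (fun m : M => delta m).
Proof.
move=> c m n; rewrite scalerDr !scalerA; congr (_ *: _ + _).
by rewrite mulrBl mulrBr mul1r mulr1 ge_comm_scalar.
Qed.

Lemma delta_act M g (m : M) : g \in H -> delta (ge g *: m) = ge g *: delta m.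
Proof.
by move=> gH; rewrite !scalerA mulrBl mulrBr mul1r mulr1 !geM yH.
Qed.

Lemma delta_linear M N (f : {linear M -> N}) m : f (delta m) = delta (f m).
Proof. exact: linearZ_LR. Qed.

(** Expresses that y acts as the identity on M in the stable category of kH. *)
Definition delta_trivial M := is_trace H (fun m : M => delta m).

Lemma delta_trivial_module : delta_trivial (trivial_module k gT).
Proof.
exists (fun _ => 0) => [c m n|m]; first by rewrite scaler0 addr0.
rewrite /trace big1 => [|u _]; last by rewrite scaler0.
rewrite scalerBl scale1r [_ *: m]/GRing.scale /= /triv_scale.
by rewrite augmentation_ge mul1r subrr.
Qed.

(** With d = y - 1, which commutes with f and g: d = g d f - d (g f - 1), a difference of traces
    over H. *)
Lemma delta_trivial_retract M N (f : {linear M -> N}) (g : {linear N -> M}) :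
  stably_trivial (fun x => g (f x) - x) -> delta_trivial N -> delta_trivial M.
Proof.
move=> /stably_trivialP/(is_trace_sub H) gf dN.
have T1 : is_trace H (fun m => g (delta (f m))).
  apply: (is_trace_compl (f := fun m => delta (f m))).
  - exact: klinear_lin.
  - by move=> *; exact: linearZ_LR.
  apply: is_trace_compr dN; first exact: klinear_lin.
  by move=> *; exact: linearZ_LR.
have T2 : is_trace H (fun m => delta (g (f m) - m)).
  apply: is_trace_compl gf; first exact: delta_klinear.
  by move=> *; exact: delta_act.
have [h hl hE] := is_traceB T1 T2.
exists h => // m; rewrite -hE delta_linear -scalerBr opprB.
by rewrite subrKC.
Qed.

(** Dimension shifting along K -> P -> L. A trace expression for y - 1 at one end is transported to
    P by k-linear splittings. Subtracting it from y - 1 on P leaves a kH-map that induces y - 1 at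
    the other end through P, whose identity is a trace over H. *)
Lemma delta_trivial_Omega K L :
  is_Omega K L -> delta_trivial K <-> delta_trivial L.
Proof.
move=> [P [i [q [pP iI qS ex]]]].
have qi z : q (i z) = 0 by apply/ex; exists z.
have [s sl qs] := klinear_section (klinear_lin q) qS.
have [th thl thE] := is_trace_sub H (projective_trace pP).
have qact g x : g \in H -> q (ge g *: x) = ge g *: q x.
  by move=> _; exact: linearZ_LR.
have iact g x : g \in H -> i (ge g *: x) = ge g *: i x.
  by move=> _; exact: linearZ_LR.
split=> [[h hl hE]|[h hl hE]].
  (* [r0] is the k-linear retraction of P onto K that belongs to the section s. *)
  have /boolp.choice[r0 r0P] p : exists z, i z = p - s (q p).
    by apply/ex; rewrite linearB /= qs subrr.
  have rl : klinear r0.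
    move=> c m n; apply: iI; rewrite linearP !r0P linearP sl scalerBr.
    by rewrite opprD addrACA.
  have ri z : r0 (i z) = z by apply: iI; rewrite r0P qi (klinear0 sl) subr0.
  pose alpha p := trace H (fun p => i (h (r0 p))) p.
  have ihl : klinear (fun p => i (h (r0 p))).
    exact/(klinear_comp (klinear_lin i))/klinear_comp.
  have al : klinear (fun p => delta p - alpha p).
    apply/klinearD_fun/klinearN_fun/klinear_trace => //; exact: delta_klinear.
  have ai z : delta (i z) - alpha (i z) = 0.
    rewrite /alpha trace_comp_arg // -delta_linear hE.
    rewrite (trace_comp (klinear_lin i)) //; apply/eqP; rewrite subr_eq0.
    by apply/eqP/eq_bigr => u _; rewrite ri.
  (* As y - 1 - alpha vanishes on i(K), it factors through q, and beta is the factor L -> P. *)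
  pose beta l := delta (s l) - alpha (s l).
  have bl : klinear beta by exact: klinear_comp al sl.
  have bq p : beta (q p) = delta p - alpha p.
    have := ai (r0 p); rewrite r0P (klinearB al) => /eqP.
    by rewrite subr_eq0 => /eqP ->.
  have bact g l : g \in H -> beta (ge g *: l) = ge g *: beta l.
    move=> gH; rewrite -{1}[l]qs -qact // bq delta_act // /alpha trace_act //.
    by rewrite -scalerBr.
  exists (fun l => q (th (beta l))) => [|l].
    exact/(klinear_comp (klinear_lin q))/(klinear_comp thl).
  have -> : delta l = q (beta l).
    rewrite /beta linearB /= delta_linear qs /alpha.
    rewrite (trace_comp (klinear_lin q)) // /trace big1 ?subr0 // => u _.
    by rewrite qi scaler0.
  by rewrite {1}[beta l]thE (trace_comp (klinear_lin q)) // trace_comp_arg.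
(* Conversely, y - 1 - alpha has image in ker q, hence equals i beta with beta : P -> K. *)
pose alpha p := trace H (fun p => s (h (q p))) p.
have /boolp.choice[beta bE] p : exists z, i z = delta p - alpha p.
  apply/ex; rewrite linearB /= delta_linear hE /alpha.
  rewrite (trace_comp (klinear_lin q)) // trace_comp_arg //.
  by apply/eqP; rewrite subr_eq0; apply/eqP/eq_bigr => u _; rewrite qs.
have shl : klinear (fun p => s (h (q p))).
  exact/(klinear_comp sl)/(klinear_comp hl)/klinear_lin.
have bl : klinear beta.
  move=> c m n; apply: iI; rewrite linearP !bE.
  rewrite (delta_klinear c) /alpha (klinear_trace H shl c) scalerBr.
  by rewrite opprD addrACA.
have bact g p : g \in H -> beta (ge g *: p) = ge g *: beta p.
  move=> gH; apply: iI; rewrite iact // !bE delta_act // /alpha trace_act //.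
  by rewrite scalerBr.
have bi z : beta (i z) = delta z.
  apply: iI; rewrite bE delta_linear /alpha trace_comp_arg // /trace big1.
    by rewrite subr0.
  by move=> u _; rewrite qi (klinear0 hl) (klinear0 sl) scaler0.
exists (fun z => beta (th (i z))) => [|z].
  exact/(klinear_comp bl)/(klinear_comp thl)/klinear_lin.
by rewrite -bi {1}[i z]thE (trace_comp bl) // trace_comp_arg.
Qed.

Lemma delta_trivial_Omega_iter n K M : is_Omega_iter n K M ->
  delta_trivial K <-> delta_trivial M.
Proof.
elim: n K => [|n IHn] K /=.
  move=> [f [g [gf fg]]]; split; first exact: (delta_trivial_retract fg).
  exact: (delta_trivial_retract gf).
by move=> [L [/IHn LM /delta_trivial_Omega KL]]; rewrite KL.
Qed.

(** For negative i it is k that is an iterated Omega of X, so dimension shifting is used in the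
    opposite direction. *)
Lemma delta_trivial_Omega_pow i X :
  is_Omega_pow i X (trivial_module k gT) -> delta_trivial X.
Proof.
case: i => n Xn; first apply/(@delta_trivial_Omega_iter n _ _ Xn).
  exact: delta_trivial_module.
by apply/(@delta_trivial_Omega_iter n.+1 _ _ Xn); exact: delta_trivial_module.
Qed.

End CentralElements.

(** * A non-trivial ghost *)

Section Submodules.
Variables (R : nzRingType) (A : lmodType R) (S : {pred A}).

(** The closure proof is a parameter, so that the type alone determines the module structure. *)
Record submodule (S_closed : submod_closed S) :=
  Submodule { submodule_val :> A; _ : submodule_val \in S }.

Variable S_closed : submod_closed S.
HB.instance Definition _ := [isSub for @submodule_val S_closed].
HB.instance Definition _ := [Choice of submodule S_closed by <:].
HB.instance Definition _ := GRing.SubChoice_isSubLmodule.Build R A S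
  (submodule S_closed) (GRing.submod_closed_semi S_closed).

Lemma submodule_valP (a : R) (u v : submodule S_closed) :
  submodule_val (a *: u + v) = a *: submodule_val u + submodule_val v.
Proof. by rewrite -[submodule_val (_ + _)]/(val _) linearP. Qed.

End Submodules.

Section LeftIdeals.
Variables (k : fieldType) (gT : finGroupType).
Local Notation kG := (group_algebra k gT).
Local Notation ge := (@ge k gT).
Variables (S : {pred kG^o}) (S_closed : submod_closed S).

Lemma regular_scalarE (c : k) (a : kG^o) x :
  (c%:A *: a : kG^o) x = c * (a : kG) x.
Proof. by rewrite -[LHS]/((c%:A * (a : kG)) x) mulr_algl ffunE. Qed.

Lemma left_ideal_coefP (c : k) (a b : submodule S_closed) x :
  (submodule_val (c%:A *: a + b) : kG) x =
    c * (submodule_val a : kG) x + (submodule_val b : kG) x.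
Proof. by rewrite submodule_valP [LHS]ffunE regular_scalarE. Qed.

Lemma left_ideal_sum (I : Type) (r : seq I) (Q : pred I)
    (F : I -> submodule S_closed) x :
  (submodule_val (\sum_(i <- r | Q i) F i) : kG) x =
    \sum_(i <- r | Q i) (submodule_val (F i) : kG) x.
Proof.
have D a b : (submodule_val (a + b : submodule S_closed) : kG) x =
    (submodule_val a : kG) x + (submodule_val b : kG) x.
  by have := left_ideal_coefP 1 a b x; rewrite scale1r scale1r mul1r.
apply: (big_morph _ D).
apply: (addrI ((submodule_val (0 : submodule S_closed) : kG) x)).
by rewrite -D !addr0.
Qed.

(** A k-linear retraction of kG onto the ideal carries the group elements to a spanning family. *)
Lemma left_ideal_finite_dim : finite_dim (submodule S_closed).
Proof.
have [|s sl sP] := @klinear_pinv k gT (submodule S_closed) kG^o val.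
  by move=> c x y; rewrite linearP.
exists #|gT|, (fun i => s (ge (enum_val i))) => a.
exists (fun i => (val a : kG) (enum_val i)).
transitivity (s (val a)); first by apply: val_inj; apply/esym/sP.
rewrite [X in s X]ga_sum (klinear_sum sl).
rewrite (reindex (@enum_val _ predT)) /=; last exact/onW_bij/enum_val_bij.
by apply: eq_bigr => i _; rewrite -(klinearZ sl).
Qed.

End LeftIdeals.

Section AffineIdeal.
Variables (k : fieldType) (gT : finGroupType).
Local Notation kG := (group_algebra k gT).
Local Notation ge := (@ge k gT).
Variables (H : {group gT}) (y : gT) (lam : gT -> k).
Hypothesis yH : y \in H.
Hypothesis abH : abelian H.
Hypothesis lamM : {in H &, {morph lam : u v / (u * v)%g >-> u + v}}.
Hypothesis lamy : lam y = 1.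

(* The module coinduced from the H-module k^2 on which h acts by             *)
(* [[1, lam h], [0, 1]], realised as a left ideal: an element a determines   *)
(* the k^2-valued function with components a and a * (y - 1).                *)
Definition affine : {pred kG^o} :=
  fun a : kG => [forall h in H, a * (ge h - 1) == lam h *: (a * (ge y - 1))].

Lemma affineP (a : kG) : reflect
  (forall h, h \in H -> a * (ge h - 1) = lam h *: (a * (ge y - 1)))
  (a \in affine).
Proof. exact: eqfun_inP. Qed.

Lemma affine_closed : submod_closed affine.
Proof.
split=> [|b u v /affineP uA /affineP vA].
  by apply/affineP => h _; rewrite !mul0r scaler0.
apply/affineP => h hH; rewrite !mulrDl vA // scalerDr; congr (_ + _).
by rewrite -[b *: u]/(b * u : kG) -!mulrA uA // -scalerAr.
Qed.

Local Notation M := (submodule affine_closed).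

Lemma affine_delta (a : kG) : a \in affine -> a * (ge y - 1) \in affine.
Proof.
move=> /affineP aA; apply/affineP => h hH.
have hy : (ge y - 1) * (ge h - 1) = (ge h - 1) * (ge y - 1).
  rewrite !mulrBl !mulrBr !mul1r !mulr1 !geM (centsP abH _ yH _ hH).
  by rewrite !opprB addrACA [in RHS]addrACA [- ge h - _]addrC.
by rewrite -mulrA hy mulrA aA // -scalerAl.
Qed.

(** Right multiplication by y - 1 commutes with the left action; it is the map coinduced from y - 1
    on k^2. *)
Definition affine_map (a : M) : M :=
  Submodule affine_closed (affine_delta (valP a)).

Lemma affine_map_linear : linear affine_map.
Proof.
move=> b u v; apply: val_inj; rewrite [RHS]linearP /=.
transitivity ((b * (submodule_val u : kG) + submodule_val v) * (ge y - 1)).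
  by congr (_ * _); apply: submodule_valP.
by rewrite mulrDl -mulrA.
Qed.

Lemma mul_ge_sub1E (a : kG) h x : (a * (ge h - 1)) x = a (x * h^-1)%g - a x.
Proof. by rewrite mulrBr mulr1 !ffunE -mul_geE ffunE. Qed.

Lemma affine_coef (a : kG) h x : a \in affine -> h \in H ->
  a (x * h^-1)%g = a x + lam h * (a * (ge y - 1)) x.
Proof.
move=> /affineP aA hH.
have /ffunP/(_ x) := aA h hH; rewrite [X in _ = X -> _]ffunE => <-.
by rewrite mul_ge_sub1E subrKC.
Qed.

(** Projection onto the component of the coinduced module at the coset H; it turns a trace over H
    into one over G. *)
Lemma affine_restrict (a : kG) :
  a \in affine -> ([ffun x => if x \in H then a x else 0] : kG) \in affine.
Proof.
move=> aA; apply/affineP => h hH; apply/ffunP => x.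
rewrite [RHS]ffunE !mul_ge_sub1E !ffunE !groupMr ?groupV //.
case: ifP => _; last by rewrite subrr mulr0.
by rewrite !affine_coef // lamy mul1r [a x + _]addrC addrK [a x + _]addrC addrK.
Qed.

Lemma affine_map_ghost (f : {linear M -> M}) : f =1 affine_map -> ghost f.
Proof.
move=> fE i X Xi h; apply/stably_trivialP.
have yC u : u \in H -> commute y u by move=> uH; apply: (centsP abH).
have [phi phil phiE] := delta_trivial_Omega_pow yC Xi.
(* The coefficient at 1 recovers all of h, by [etaE]; following h by right multiplication by y - 1
   becomes acting on m by y - 1. *)
pose eta m : k := (val (h m) : kG) 1%g.
have etaE m x : (val (h m) : kG) x = eta (ge x^-1 *: m).
  by rewrite /eta linearZ_LR /= ge_mulE invgK mulg1.
have etal (c : k) m n : eta (c%:A *: m + n) = c * eta m + eta n.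
  rewrite /eta linearP linearP ffunE; congr (_ + _).
  exact: regular_scalarE.
have etaD m n : eta (m + n) = eta m + eta n.
  by have := etal 1 m n; rewrite !scale1r mul1r.
have eta0 : eta 0 = 0 by apply: (addrI (eta 0)); rewrite -etaD !addr0.
have etaB m n : eta (m - n) = eta m - eta n.
  by have := etal (-1) n m; rewrite !scaleN1r mulN1r addrC [RHS]addrC.
pose Phi m : M := Submodule affine_closed (affine_restrict (valP (h (phi m)))).
exists Phi => [c m n|m].
  apply: val_inj; rewrite linearP /=; apply/ffunP => x; rewrite [RHS]ffunE.
  rewrite regular_scalarE !ffunE; case: ifP => _; last by rewrite mulr0 addr0.
  by rewrite phil linearP; apply: left_ideal_coefP.
apply: val_inj; apply/ffunP => x.
have -> : (val (f (h m)) : kG) x = eta ((ge y - 1) *: (ge x^-1 *: m)).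
  rewrite fE /= mul_ge_sub1E !etaE invMg invgK -geM -scalerA.
  by rewrite scalerBl scale1r etaB.
rewrite phiE (big_morph eta etaD eta0) linear_sum /= sum_ffunE.
(* With g = x u, the coefficient at x is read off at u^-1, so the cut-off in [Phi] keeps exactly the
   u in H. *)
rewrite [RHS](reindex_inj (mulgI x)) /=.
rewrite big_mkcond [RHS]big_mkcond; apply: eq_bigr => u _.
rewrite in_setT ge_mulE ffunE invMg mulgKV groupV; case: ifP => // uH.
by rewrite etaE invgK !scalerA geM.
Qed.


Lemma lam1 : lam 1%g = 0.
Proof. by apply: (addrI (lam 1%g)); rewrite -lamM // mulg1 addr0. Qed.

Lemma lamV h : h \in H -> lam h^-1%g = - lam h.
Proof.
by move=> hH; apply: (addrI (lam h)); rewrite -lamM ?groupV // mulgV lam1 subrr.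
Qed.

Lemma affine_indicator : ([ffun x => (x \in H)%:R] : kG) \in affine.
Proof.
apply/affineP => h hH; apply/ffunP => x.
by rewrite [RHS]ffunE !mul_ge_sub1E !ffunE !groupMr ?groupV // !subrr mulr0.
Qed.

Lemma affine_lam : ([ffun x => if x \in H then lam x else 0] : kG) \in affine.
Proof.
apply/affineP => h hH; apply/ffunP => x.
rewrite [RHS]ffunE !mul_ge_sub1E !ffunE !groupMr ?groupV //.
case: ifP => xH; last by rewrite subrr mulr0.
by rewrite !lamM ?groupV // !lamV // lamy ![lam x + _]addrC !addrK mulrN1.
Qed.

Hypothesis cardH : #|H|%:R = 0 :> k.
Hypothesis sum_lam : \sum_(u in H) lam u = 0.
Hypothesis sum_lam2 : \sum_(u in H) lam u * lam u = 0.

(** E and F, supported on H, correspond to a basis of k^2, and the map sends F to - E. The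
    coefficient at 1 of the image of F is thus -1, whereas any trace contributes 0 there, coset by
    coset. *)
Lemma affine_map_nontrivial (f : {linear M -> M}) :
  f =1 affine_map -> ~ is_trace [set: gT] f.
Proof.
move=> fE [psi psil psiE].
pose E : M := Submodule affine_closed affine_indicator.
pose F : M := Submodule affine_closed affine_lam.
have := congr1 (fun a : M => (val a : kG) 1%g) (psiE F).
rewrite fE /= mul_ge_sub1E mul1g !ffunE group1 groupV yH lam1.
rewrite lamV // lamy subr0.
rewrite /trace left_ideal_sum.
have [R _ ->] := big_cosets (subsetT H : H \subset [set: gT]%G).
rewrite big1 => [/eqP|r _]; first by rewrite oppr_eq0 oner_eq0.
have shift u : u \in H -> ge u^-1 *: F = (lam u)%:A *: E + F.
  move=> uH; apply: val_inj; apply/ffunP => x.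
  rewrite [RHS]left_ideal_coefP linearZ_LR ge_mulE !ffunE invgK groupMl //.
  by case: ifP => xH; rewrite ?lamM // ?mulr1 // mulr0 addr0.
pose A := psi (ge r^-1 *: F); pose B := psi (ge r^-1 *: E).
have AE u : u \in H -> psi (ge (u * r)^-1 *: F) = (lam u)%:A *: B + A.
  move=> uH; rewrite invMg -geM -scalerA shift // scalerDr scalerA.
  by rewrite ge_comm_scalar -scalerA psil.
have coefA (C : M) u : u \in H -> (submodule_val C : kG) (r^-1 * u^-1)%g =
    (submodule_val C : kG) r^-1%g +
    lam u * ((submodule_val C : kG) * (ge y - 1)) r^-1%g.
  by move=> uH; rewrite affine_coef //; exact: valP.
(* Both the argument of psi and the point of evaluation depend affinely on lam u, so each summand is
   a polynomial of degree at most 2 in lam u. *)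
under eq_bigr => u uH.
  rewrite ge_mulE mulg1 AE // left_ideal_coefP invMg !coefA // mulrDr mulrA.
  over.
rewrite !big_split /= -!mulr_suml sum_lam sum_lam2 sumr_const.
by rewrite -mulr_natl cardH !mul0r !addr0.
Qed.

End AffineIdeal.

(** * Additive functionals on p-groups *)

Section AdditiveFunctional.
Variables (p : nat) (k : fieldType) (gT : finGroupType).
Hypotheses (p_prime : prime p) (char_k : p \in [pchar k]).

(** lam is H -> H / Q = Z/p -> k, and y lifts a generator of the quotient. *)
Lemma additive_functional (H Q : {group gT}) : (Q <| H)%g -> #|(H / Q)%g| = p ->
  exists y (lam : gT -> k),
  [/\ y \in H, {in H &, {morph lam : u v / (u * v)%g >-> u + v}}, lam y = 1 &
      {in Q, forall u, lam u = 0}].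
Proof.
move=> nQH iQ; have /cyclicP[c cE] : cyclic (H / Q) by rewrite prime_cyclic ?iQ.
have oc : #[c]%g = p by rewrite -iQ cE.
have inj := injm_Zpm c.
pose d := invm inj.
have dE h : h \in H -> coset Q h \in (Zpm @* Zp #[c])%g.
  by move=> hH; rewrite im_Zpm -cE mem_quotient.
have p_gt1 : (1 < #[c]%g)%N by rewrite oc prime_gt1.
have /morphimP[y yN yH yE] : c \in (H / Q)%g by rewrite cE cycle_id.
exists y, (fun h => (d (coset Q h) : nat)%:R); split=> //.
- move=> u v uH vH.
  have [uN vN] : u \in 'N(Q)%g /\ v \in 'N(Q)%g.
    by split; apply: (subsetP (normal_norm nQH)).
  rewrite morphM // /d morphM ?dE //=.
  rewrite [X in (_ %% X)%N]Zp_cast // [X in (_ %% X)%N]oc.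
  by rewrite (GRing.natr_mod_pchar char_k) natrD.
- have -> : coset Q y = Zpm (1 : 'Z_#[c]%g).
    by rewrite /Zpm /= modn_small // expg1 yE.
  by rewrite /d invmE ?mem_Zp //= modn_small.
- by move=> u uQ; rewrite coset_id // /d morph1.
Qed.

(** Here the bound 3 enters: in order 2 the sum of lam is 1, and in order 3 the sum of lam^2 is 1 +
    4 = 2. *)
Lemma additive_functional_moments (H : {group gT}) :
  (p.-group H)%g -> (3 < #|H|)%N ->
  exists y (lam : gT -> k),
  [/\ y \in H, {in H &, {morph lam : u v / (u * v)%g >-> u + v}}, lam y = 1,
      \sum_(u in H) lam u = 0 & \sum_(u in H) lam u * lam u = 0].
Proof.
move=> pH H3; have [m mE] : exists m, #|H| = (p ^ m)%N.
  by exists (logn p #|H|); rewrite -(p_part) part_pnat_id.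
case: m mE => [|m] mE; first by rewrite mE in H3.
have [|Q [sQH nQH cQ]] := @normal_pgroup p gT m H H pH (normal_refl H).
  by rewrite mE pfactorK.
have [|y [lam [yH lamM lamy lamQ]]] := additive_functional nQH.
  rewrite card_quotient ?normal_norm // -divgS // mE cQ expnS mulnK //.
  by rewrite expn_gt0 prime_gt0.
suff [S1 S2] : \sum_(u in H) lam u = 0 /\ \sum_(u in H) lam u * lam u = 0.
  by exists y, lam.
have lamQr u r : u \in Q -> r \in H -> lam (u * r)%g = lam r.
  move=> uQ rH; rewrite lamM //; first by rewrite lamQ ?add0r.
  exact: (subsetP sQH).
have pk0 : p%:R = 0 :> k by case/andP: char_k => _ /eqP.
(* If |H| = p then p > 3, and u |-> u^2 multiplies the moments by 2 and 4;   *)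
(* otherwise lam is constant on the cosets of Q, whose order p divides.      *)
case: m => [|m] in mE cQ.
  have p3 : (3 < p)%N by rewrite mE expn1 in H3.
  have co : coprime #|H| 2.
    rewrite mE expn1 prime_coprime // dvdn_prime2 //.
    by apply: contraTneq p3 => ->.
  have dbl u : u \in H -> lam (u ^+ 2)%g = 2 * lam u.
    by move=> uH; rewrite expgS expg1 lamM // mulr_natl.
  have reix (F : gT -> k) : \sum_(u in H) F (u ^+ 2)%g = \sum_(u in H) F u.
    pose rt (u : gT) : gT := (u ^+ expg_invn H 2)%g.
    rewrite [RHS](reindex_onto (fun u => u ^+ 2)%g rt) => [|u uH].
      apply: eq_bigl => u; apply/idP/andP => [uH|[u2H /eqP <-]].
        by rewrite groupX // /rt expgK.
      exact: groupX.
    by rewrite /rt expgAC expgK.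
  have k_neq0 n : (0 < n < p)%N -> n%:R != 0 :> k.
    by move=> n_p; rewrite -(dvdn_pcharf char_k) gtnNdvd; case/andP: n_p.
  split.
    apply/eqP; have := reix lam; under eq_bigr => u uH do rewrite dbl //.
    by rewrite -mulr_sumr mulr_natl mulr2n => /eqP; rewrite -subr_eq0 addrK.
  have := reix (fun u => lam u * lam u).
  under eq_bigr => u uH do rewrite dbl // mulrACA.
  (* Writing 4 as 1 + 3 leaves 3 times the second moment equal to 0, and 3 is invertible since p >
     3. *)
  rewrite -mulr_sumr -natrM (mulrS 1 3) mulrDl mul1r => /eqP.
  rewrite -subr_eq0 addrAC subrr add0r mulf_eq0 (negPf (k_neq0 3 _)) //.
  by move/eqP.
have fib (F : gT -> k) :
    (forall u r, u \in Q -> r \in H -> F (u * r)%g = F r) ->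
    \sum_(u in H) F u = 0.
  move=> FQ; have [R /subsetP sRH ->] := big_cosets sQH.
  rewrite big1 // => r /sRH rH.
  rewrite (eq_bigr (fun=> F r)) => [|u uQ]; last exact: FQ.
  by rewrite sumr_const cQ expnS mulrnA -[_ *+ p]mulr_natr pk0 mulr0 mul0rn.
by split; apply: fib => u r uQ rH; rewrite !lamQr.
Qed.

(** A cyclic subgroup of order p serves if p > 3, and a subgroup of order p^2 otherwise. *)
Lemma large_abelian_subgroup (G : {group gT}) :
  (p.-group G)%g -> (3 < #|G|)%N ->
  exists H : {group gT}, [/\ H \subset G, abelian H & (3 < #|H|)%N].
Proof.
move=> pG G3; have [p3|p3] := ltnP 3 p.
  have [|x xG ox] := @Cauchy gT p G p_prime.
    have /p_natP[m mE] := pG; rewrite mE.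
    case: m mE => [E|m _]; last exact: dvdn_exp.
    by rewrite E in G3.
  by exists <[x]>%G; rewrite cycle_subG xG cycle_abelian -orderE ox.
have [|H [sHG _ cH]] := @normal_pgroup p gT 2 G G pG (normal_refl G).
  have /p_natP[m mE] := pG; rewrite mE pfactorK //.
  case: m mE => [|[|m]] E //; first by rewrite E in G3.
  by rewrite E expn1 ltnNge p3 in G3.
exists H; split=> //; first exact: card_p2group_abelian cH.
by rewrite cH; apply: (@leq_trans (2 ^ 2)); rewrite // leq_exp2r // prime_gt1.
Qed.

End AdditiveFunctional.

(** * Testing ghosts on k and Omega^-1 k *)

Section GhostConditions.
Variables (k : fieldType) (gT : finGroupType).
Local Notation kG := (group_algebra k gT).
Local Notation ge := (@ge k gT).
Local Notation k1 := (trivial_module k gT).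
Implicit Types (M N : lmodType kG).

Definition norm_elt : kG := \sum_g ge g.

Lemma norm_eltE x : norm_elt x = 1.
Proof.
rewrite sum_ffunE (bigD1 x) //= ffunE eqxx big1 ?addr0 // => g /negPf gx.
by rewrite ffunE eq_sym gx.
Qed.

Lemma triv_scalarE (c : k) (x : k1) : c%:A *: x = c * (x : k) :> k.
Proof.
rewrite [_ *: _]/GRing.scale /= /triv_scale /augmentation.
under eq_bigr => g _ do rewrite ffunE.
by rewrite -mulr_sumr -/(augmentation _) augmentation1 mulr1.
Qed.

Lemma stably_iso_refl M : stably_iso M M.
Proof.
have T0 : stably_trivial (fun x : M => idfun x - x).
  apply/stably_trivialP; exists (fun _ => 0) => [c x y|x].
    by rewrite scaler0 addr0.
  by rewrite /trace subrr big1 // => u _; rewrite scaler0.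
by exists idfun, idfun.
Qed.

(** A fixed vector is a map k -> M. Its composite with f is a trace of some phi, whose value at 1 is
    the norm element times phi(1). *)
Lemma ghost_fixed M N (f : {linear M -> N}) m : ghost f ->
  (forall g, ge g *: m = m) -> exists n, f m = norm_elt *: n.
Proof.
move=> fgh mG.
have hl : linear (fun c : k1 => (c : k)%:A *: m : M).
  apply: klinear_linear => [c x z|g x].
    rewrite -[c%:A *: x]/(c%:A *: x : k) triv_scalarE !scalerDl.
    by rewrite scalerA mulr_algl scalerA.
  rewrite [RHS]scalerA ge_comm_scalar -[RHS]scalerA mG; congr (_%:A *: _).
  by rewrite [_ *: _]/GRing.scale /= /triv_scale augmentation_ge mul1r.
have [h hE] := linear_pack hl.
have /stably_trivialP[phi phil phiE] := fgh 0 k1 (stably_iso_refl _) h.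
exists (phi (1 : k)); have := phiE (1 : k); rewrite hE !scale1r => ->.
rewrite /trace scaler_suml; apply: eq_big => [g|g _]; first by rewrite in_setT.
congr (_ *: phi _).
by rewrite [_ *: _]/GRing.scale /= /triv_scale augmentation_ge mul1r.
Qed.

Lemma regular_projective : projective kG^o.
Proof.
move=> M N q f qS; have [m mE] := qS (f 1).
have hl : linear (fun a : kG^o => a *: m).
  by move=> a b c; rewrite scalerDl scalerA.
have [h hE] := linear_pack hl.
exists h => a; rewrite hE linearZ_LR mE -linearZ_LR.
exact: (congr1 f (mulr1 (a : kG))). 
Qed.

Section Cyclic.
Variable y : gT.
Hypothesis Gy : [set: gT] = <[y]>%g.
Local Notation t := (ge y - 1).

Lemma mul_delta_eq0 (a : kG) : a * t = 0 <-> exists c : k, a = [ffun=> c].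
Proof.
split=> [/ffunP at0|[c ->]]; last first.
  by apply/ffunP => x; rewrite mul_ge_sub1E !ffunE subrr.
have aV x : a (x * y^-1)%g = a x.
  have := at0 x; rewrite mul_ge_sub1E !ffunE => /eqP.
  by rewrite subr_eq0 => /eqP.
exists (a 1%g); apply/ffunP => x; rewrite ffunE.
have /cycleP[n ->] : x \in <[y]>%g by rewrite -Gy in_setT.
by elim: n => // n <-; rewrite expgSr -[LHS]aV mulgK.
Qed.

(** The ideal kG (y - 1), isomorphic to kG modulo the norm element, represents Omega^-1 k when y
    generates G. *)
Definition delta_ideal : {pred kG^o} :=
  fun b : kG => boolp.asbool (exists a, b = a * t).

Lemma delta_ideal_closed : submod_closed delta_ideal.
Proof.
split=> [|c _ _ /boolp.asboolP[a ->] /boolp.asboolP[b ->]].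
  by apply/boolp.asboolP; exists 0; rewrite mul0r.
apply/boolp.asboolP; exists (c * a + b).
by rewrite mulrDl -mulrA.
Qed.

Local Notation X := (submodule delta_ideal_closed).

Lemma delta_ideal_mul (a : kG) : a * t \in delta_ideal.
Proof. by apply/boolp.asboolP; exists a. Qed.

Lemma delta_ideal_Omega : is_Omega k1 X.
Proof.
have il : linear (fun c : k1 => [ffun=> (c : k)] : kG^o).
  move=> b c d; have E : b * ([ffun=> c] : kG) = [ffun=> augmentation b * c].
    apply/ffunP => x; rewrite !ffunE /augmentation mulr_suml.
    by apply: eq_bigr => h _; rewrite ffunE.
  apply/ffunP => x; rewrite [RHS]ffunE.
  by rewrite -[X in _ = X + _]/((b * ([ffun=> c] : kG) : kG) x) E !ffunE.
have ql : linear (fun a : kG^o =>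
    Submodule delta_ideal_closed (delta_ideal_mul a)).
  move=> b u v; apply: val_inj; rewrite [RHS]submodule_valP /=.
  by rewrite mulrDl -mulrA.
have [i iE] := linear_pack il; have [q qE] := linear_pack ql.
exists kG^o, i, q; split; first exact: regular_projective.
- by move=> c d; rewrite !iE => /ffunP/(_ 1%g); rewrite !ffunE.
- move=> b; have /boolp.asboolP[a aE] := valP b.
  by exists a; rewrite qE; apply: val_inj; rewrite /= -aE.
move=> a; rewrite qE; split=> [/(congr1 val)/= at0|[c ca]].
  by have /mul_delta_eq0[c ->] := at0; exists c; rewrite iE.
by apply: val_inj => /=; apply/mul_delta_eq0; exists c; rewrite -ca iE.
Qed.

(** A vector killed by the norm element is a map from Omega^-1 k = kG t, sending a t to a m. Stable
    triviality of its composite with f extends that composite to kG, so the image of t is t times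
    the image of 1. *)
Lemma ghost_norm_eq0 M N (f : {linear M -> N}) m : ghost f ->
  norm_elt *: m = 0 -> exists n, f m = t *: n.
Proof.
move=> fgh nm0.
have /boolp.choice[al alE] (b : X) : exists a : kG, (val b : kG) = a * t.
  by have /boolp.asboolP := valP b.
have alU (b : X) (a : kG) : (val b : kG) = a * t -> al b *: m = a *: m.
  move=> bE; apply/eqP; rewrite -subr_eq0 -scalerBl.
  have /mul_delta_eq0[c ->] : (al b - a) * t = 0.
    by rewrite mulrBl -alE bE subrr.
  have -> : ([ffun=> c] : kG) = c%:A * norm_elt.
    by apply/ffunP => x; rewrite mulr_algl !ffunE norm_eltE mulr1.
  by rewrite -scalerA nm0 scaler0.
have hl : linear (fun b : X => al b *: m).
  move=> c u v; rewrite (alU _ (c * al u + al v)) ?scalerDl ?scalerA //.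
  rewrite mulrDl -mulrA -!alE. exact: (submodule_valP c u v).
have [h hE] := linear_pack hl.
have XO : is_Omega_pow (Negz 0) X k1.
  by exists X; split; [exact: stably_iso_refl | exact: delta_ideal_Omega].
have /stably_trivialP[phi phil phiE] := fgh _ X XO h.
have [|pi pil piE] := @klinear_pinv k gT X kG^o val.
  by move=> c u v; rewrite linearP.
(* Extending phi k-linearly to kG before taking the trace yields the extension of f h. *)
pose F (a : kG^o) := trace [set: gT] (fun b : kG^o => phi (pi b)) a.
have Fl : klinear F by apply: klinear_trace; exact: klinear_comp.
have FE (b : X) : F (val b) = f (h b).
  rewrite phiE; apply: eq_bigr => g _; rewrite -linearZ_LR; congr (_ *: phi _).
  by apply: val_inj; apply: piE.
exists (F 1); pose b := Submodule delta_ideal_closed (delta_ideal_mul 1).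
have <- : h b = m by rewrite hE (alU _ 1) ?scale1r.
rewrite -FE /= mul1r scalerBl scale1r.
rewrite -(trace_act (H := [set: gT]%G)) ?in_setT //.
by rewrite -(klinearB Fl); congr (F (_ - _)); apply/esym/(mulr1 (ge y : kG)).
Qed.

End Cyclic.
End GhostConditions.

(** * Cyclic groups of order 2 and 3 *)

Section SmallCyclic.
Variables (k : fieldType) (gT : finGroupType).
Local Notation kG := (group_algebra k gT).
Local Notation ge := (@ge k gT).
Implicit Types (M N : lmodType kG).
Variable y : gT.
Hypothesis Gy : [set: gT] = <[y]>%g.
Local Notation T m := ((ge y - 1) *: m).

Lemma sum_cyclic (V : zmodType) (F : gT -> V) :
  \sum_g F g = \sum_(i < #[y]%g) F (y ^+ i)%g.
Proof.
rewrite (reindex (fun i : 'I_#[y]%g => y ^+ i)%g) //=; apply: onW_bij.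
apply: inj_card_bij => [i j /eqP|]; last by rewrite card_ord -cardsT Gy.
by rewrite eq_expg_mod_order !modn_small // => /eqP/ord_inj.
Qed.

Lemma klinear_delta M N (f : M -> N) : klinear f -> klinear (fun m => T (f m)).
Proof. by move=> fl; apply: klinear_comp fl; apply: delta_klinear. Qed.

Lemma delta_comm M N (f : M -> N) m : klinear f ->
  (forall g x, f (ge g *: x) = ge g *: f x) -> f (T m) = T (f m).
Proof. by move=> fl fg; rewrite !scalerBl !scale1r (klinearB fl) fg. Qed.

Lemma is_trace_act M N (f : M -> N) g x :
  is_trace [set: gT] f -> f (ge g *: x) = ge g *: f x.
Proof.
by move=> [h hl hE]; rewrite !hE (trace_act (H := [set: gT]%G)) ?in_setT.
Qed.

Lemma is_trace_klinear M N (f : M -> N) : is_trace [set: gT] f -> klinear f.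
Proof. by move=> [h hl hE] c x z; rewrite !hE klinear_trace. Qed.

Lemma is_trace_correct M N (f h : M -> N) :
  is_trace [set: gT] h -> is_trace [set: gT] (fun x => f x - h x) ->
  is_trace [set: gT] f.
Proof.
move=> hT fhT; have [u ul uE] := is_traceB fhT (is_traceN hT).
by exists u => // x; rewrite -uE opprK subrK.
Qed.

(** Shifting the k-linear map by y^-1 makes the trace homogeneous of degree |G| - 1. In
    characteristic p with |G| = p, the polynomial (X^p - Z^p)/(X - Z) is unchanged under X -> X - 1,
    Z -> Z - 1, so y may be replaced by t; [casimir2] and [casimir3] are the cases p = 2, 3. *)
Lemma trace_cyclic M N (phi : M -> N) : klinear phi ->
  is_trace [set: gT] (fun m =>
    \sum_(i < #[y]%g) ge (y ^+ i) *: phi (ge (y ^+ (#[y]%g - i.+1)) *: m)).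
Proof.
move=> phil; exists (fun m => phi (ge y^-1%g *: m)) => [|m].
  exact: klinear_act_arg.
transitivity (\sum_g ge g *: phi (ge y^-1%g *: (ge g^-1%g *: m))).
  rewrite sum_cyclic; apply: eq_bigr => i _; congr (_ *: phi _).
  rewrite scalerA geM -invMg -expgSr; congr (ge _ *: m).
  by apply/eqP; rewrite eq_sym eq_invg_mul -expgD subnKC // expg_order.
by apply: eq_bigl => g; rewrite in_setT.
Qed.

Lemma act_delta M (m : M) : ge y *: m = m + T m.
Proof. by rewrite scalerBl scale1r subrKC. Qed.

Lemma delta_eq0_fixed M (m : M) g : T m = 0 -> ge g *: m = m.
Proof.
move=> Tm; have ym : ge y *: m = m by rewrite act_delta Tm addr0.
have /cycleP[n ->] : g \in <[y]>%g by rewrite -Gy in_setT.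
by elim: n => [|n IHn]; rewrite ?ge1 ?scale1r // expgS -geM -scalerA IHn.
Qed.

Lemma norm_delta_eq0 M (m : M) : norm_elt k gT *: T m = 0.
Proof.
rewrite scalerA; have -> : norm_elt k gT * (ge y - 1) = 0; last exact: scale0r.
by apply/ffunP => x; rewrite mul_ge_sub1E !norm_eltE subrr ffunE.
Qed.

Section Order2.
Hypotheses (oy : #[y]%g = 2) (char2 : 2 \in [pchar k]).

Lemma double_eq0 M (m : M) : m + m = 0.
Proof.
rewrite -mulr2n -scaler_nat -[2%:R](scaler_nat 2 (1 : kG)).
by have /andP[_ /eqP->] := char2; rewrite !scale0r.
Qed.

Lemma casimir2 M N (phi : M -> N) : klinear phi ->
  is_trace [set: gT] (fun m => T (phi m) + phi (T m)).
Proof.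
move=> phil; have [h hl hE] := trace_cyclic phil; exists h => // m.
rewrite -hE oy !big_ord_recl big_ord0 /= !expg0 !expg1 !ge1 !scale1r addr0.
rewrite !act_delta (klinearD phil) [phi m + T _]addrC addrACA.
by rewrite [phi (T m) + _]addrC addrACA double_eq0 add0r addrC.
Qed.

Lemma norm_elt2 M (m : M) : norm_elt k gT *: m = T m.
Proof.
rewrite scaler_suml sum_cyclic oy !big_ord_recl big_ord0 /= addr0 expg0 expg1.
by rewrite ge1 scale1r act_delta addrA double_eq0 add0r.
Qed.

(** On ker t the map T s f equals f, since f m lies in im t; so [f1] kills ker t. Then f1 = f1 u T
    and T f1 = f1 T = 0, which makes f1 the trace obtained from phi = f1 u. *)
Lemma ghost_is_trace2 M N (f : {linear M -> N}) :
  ghost f -> is_trace [set: gT] f.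
Proof.
move=> fgh; have fl := klinear_lin f.
have TT0 (L : lmodType kG) (m : L) : T (T m) = 0.
  by rewrite -norm_elt2 norm_delta_eq0.
have [s sl sE] := klinear_pinv (@delta_klinear k gT y N).
have [u ul uE] := klinear_pinv (@delta_klinear k gT y M).
have C1 := casimir2 (klinear_comp sl fl).
pose f1 m := f m - (T (s (f m)) + s (f (T m))).
have f1l : klinear f1.
  exact/klinearD_fun/klinearN_fun/(is_trace_klinear C1).
have f1T m : f1 (T m) = T (f1 m).
  apply: delta_comm => // g x; rewrite /f1 (is_trace_act g x C1) linearZ_LR.
  by rewrite -scalerBr.
have f1K m : T m = 0 -> f1 m = 0.
  move=> Tm; have [n nE] : exists n, f m = T n.
    have [n ->] := ghost_fixed fgh (fun g => delta_eq0_fixed g Tm).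
    by exists n; rewrite norm_elt2.
  by rewrite /f1 nE sE Tm linear0 (klinear0 sl) addr0 subrr.
apply: (is_trace_correct C1).
have [h hl hE] := casimir2 (klinear_comp f1l ul).
exists h => // m; rewrite -hE -f1T [f1 (T _)]f1K ?TT0 // add0r.
apply/eqP; rewrite -subr_eq0 -(klinearB f1l) f1K //.
by rewrite scalerBr uE subrr.
Qed.

End Order2.

Section Order3.
Hypotheses (oy : #[y]%g = 3) (char3 : 3 \in [pchar k]).

Lemma triple_eq0 M (m : M) : m + m + m = 0.
Proof.
have -> : m + m + m = m *+ 3 by rewrite !mulrS mulr0n addr0 addrA.
rewrite -scaler_nat -[3%:R](scaler_nat 3 (1 : kG)).
by have /andP[_ /eqP->] := char3; rewrite !scale0r.
Qed.

Lemma casimir3 M N (phi : M -> N) : klinear phi ->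
  is_trace [set: gT] (fun m => T (T (phi m)) + T (phi (T m)) + phi (T (T m))).
Proof.
move=> phil; have [h hl hE] := trace_cyclic phil; exists h => // m.
rewrite -hE oy !big_ord_recl big_ord0 /= addr0 /bump /= !addn0 !subnS subn0 /=.
have y2 (L : lmodType kG) (l : L) :
    ge (y ^+ 2)%g *: l = l + T l + T l + T (T l).
  by rewrite expgS expg1 -geM -scalerA !act_delta scalerDr !addrA.
rewrite !expg0 !expg1 !ge1 !scale1r !y2 !act_delta !(klinearD phil).
rewrite scalerDr !addrA.
(* Of the twelve terms, phi m, phi (T m) and T (phi m) each occur three times and cancel. *)
rewrite [RHS](ACl ((1*5*9)*(2*3*6)*(7*10*11)*12*8*4))%AC /=.
by rewrite !triple_eq0 !add0r.
Qed.

Lemma norm_elt3 M (m : M) : norm_elt k gT *: m = T (T m).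
Proof.
rewrite scaler_suml sum_cyclic oy !big_ord_recl big_ord0 /= addr0 expg0 expg1.
rewrite ge1 scale1r expgS expg1 -geM -scalerA !act_delta scalerDr !addrA.
by rewrite (ACl ((1*2*4)*(3*5*6)*7))%AC /= !triple_eq0 !add0r.
Qed.

Lemma ghost_is_trace3 M N (f : {linear M -> N}) :
  ghost f -> is_trace [set: gT] f.
Proof.
move=> fgh; have fl := klinear_lin f.
have TTT0 (L : lmodType kG) (m : L) : T (T (T m)) = 0.
  by rewrite -norm_elt3 norm_delta_eq0.
have dl (L : lmodType kG) := @delta_klinear k gT y L.
have [s sl sE] := klinear_pinv (dl N).
have [u ul uE] := klinear_pinv (dl M).
have [s2 s2l s2E] := klinear_pinv (klinear_delta (dl N)).
have [u2 u2l u2E] := klinear_pinv (klinear_delta (dl M)).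
have fK1 m : T m = 0 -> exists n, f m = T (T n).
  move=> Tm; have [n ->] := ghost_fixed fgh (fun g => delta_eq0_fixed g Tm).
    by exists n; rewrite norm_elt3.
have fK2 m : T (T m) = 0 -> exists n, f m = T n.
  by move=> TTm; apply: (ghost_norm_eq0 Gy fgh); rewrite norm_elt3.
(* Subtracting traces, f1 maps ker t^2 into im t^2 and f2 kills ker t^2. *)
have C1 := casimir3 (klinear_comp sl (klinear_comp fl ul)).
pose f1 m := f m -
  (T (T (s (f (u m)))) + T (s (f (u (T m)))) + s (f (u (T (T m))))).
have f1l : klinear f1.
  exact/klinearD_fun/klinearN_fun/(is_trace_klinear C1).
have f1g g m : f1 (ge g *: m) = ge g *: f1 m.
  by rewrite /f1 (is_trace_act g m C1) linearZ_LR -scalerBr.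
have f1T m : f1 (T m) = T (f1 m) by apply: delta_comm.
have f1K m : T (T m) = 0 -> exists n, f1 m = T (T n).
  move=> TTm; have [n1 n1E] : exists n, f (m - u (T m)) = T (T n).
    by apply: fK1; rewrite scalerBr uE subrr.
  have [n2 n2E] : exists n, f (u (T m)) = T n by apply: fK2; rewrite uE.
  exists (n1 - s (f (u m))); rewrite !scalerBr -n1E linearB /=.
  rewrite /f1 TTm (klinear0 ul) linear0 (klinear0 sl) addr0.
  by rewrite n2E sE opprD addrAC addrA addrAC.
have C2 := casimir3 (klinear_comp s2l f1l).
pose f2 m := f1 m -
  (T (T (s2 (f1 m))) + T (s2 (f1 (T m))) + s2 (f1 (T (T m)))).
have f2l : klinear f2.
  exact/klinearD_fun/klinearN_fun/(is_trace_klinear C2).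
have f2T m : f2 (T m) = T (f2 m).
  apply: delta_comm => // g x; rewrite /f2 (is_trace_act g x C2) f1g.
  by rewrite -scalerBr.
have f2K m : T (T m) = 0 -> f2 m = 0.
  move=> TTm; have [n nE] := f1K m TTm.
  rewrite /f2 TTm f1T nE s2E TTT0 (klinear0 s2l) (klinear0 f1l) (klinear0 s2l).
  by rewrite scaler0 !addr0 subrr.
apply: (is_trace_correct C1); apply: (is_trace_correct C2).
(* As m - u2 (T (T m)) lies in ker t^2, f2 equals f2 u2 T^2; the other two terms of the trace vanish
   because f2 commutes with T and T^3 = 0. *)
have [h hl hE] := casimir3 (klinear_comp f2l u2l).
exists h => // m; rewrite -hE -!f2T f2K ?TTT0 // f2K ?TTT0 // !add0r.
apply/eqP; rewrite -subr_eq0 -(klinearB f2l) f2K //.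
by rewrite !scalerBr u2E subrr.
Qed.

End Order3.

End SmallCyclic.

(** * The two implications and the theorem *)

Lemma generating_hypothesis_card_le3
    (p : nat) (gT : finGroupType) (k : fieldType) :
  prime p -> (p.-group [set: gT])%g -> p \in [pchar k] ->
  generating_hypothesis k gT -> (#|[set: gT]| <= 3)%N.
Proof.
move=> p_prime pG char_k GH; rewrite leqNgt; apply/negP => G3.
have [H [sHG abH H3]] := @large_abelian_subgroup p gT p_prime [set: gT]%G pG G3.
have pH := pgroupS sHG pG.
have [y [lam [yH lamM lamy S1 S2]]] :=
  additive_functional_moments p_prime char_k pH H3.
have [f fE] := linear_pack (affine_map_linear (lam := lam) yH abH).
have cardH : #|H|%:R = 0 :> k.
  apply/eqP; rewrite -(dvdn_pcharf char_k).
  have [|//] := pgroup_pdiv pH; by rewrite trivg_card1; case: #|H| H3 => [|[]].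
apply: (affine_map_nontrivial lamM lamy cardH S1 S2 fE).
apply/stmod_trivialP; first exact: left_ideal_finite_dim.
by apply: GH; [exact: left_ideal_finite_dim.. | apply: affine_map_ghost fE].
Qed.

Lemma generating_hypothesis_card23
    (p : nat) (gT : finGroupType) (k : fieldType) :
  (p.-group [set: gT])%g -> p \in [pchar k] ->
  #|[set: gT]| = 2 \/ #|[set: gT]| = 3 -> generating_hypothesis k gT.
Proof.
move=> pG char_k cG M N fM fN f fgh; apply/(stmod_trivialP f fN).
have Gpr : prime #|[set: gT]| by case: cG => ->.
have [y Gy] : exists y, [set: gT] = <[y]>%g by apply/cyclicP/prime_cyclic.
have oy : #[y]%g = p.
  have [|p_pr pG' _] := pgroup_pdiv pG.
    by rewrite trivg_card1; case: cG => ->.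
  by move: pG'; rewrite dvdn_prime2 // orderE -Gy => /eqP.
have cp : #|[set: gT]| = p by rewrite Gy -oy.
case: cG; rewrite cp => pE; rewrite pE in char_k oy.
  exact: ghost_is_trace2 Gy oy char_k _ _ _ fgh.
exact: ghost_is_trace3 Gy oy char_k _ _ _ fgh.
Qed.

Local Close Scope ring_scope.

Theorem theorem1p1 (p : nat) (gT : finGroupType) (k : fieldType)
    (p_prime : prime p) (pG : (p.-group [set: gT])%g)
    (ntG : [set: gT] <> 1%g) (char_k : p \in [pchar k]%R) :
  generating_hypothesis k gT <->
    ([set: gT] \isog Zp 2) \/ ([set: gT] \isog Zp 3).
Proof.
split=> [GH|isoG]; last first.
  apply: (generating_hypothesis_card23 pG char_k).
  by case: isoG => /card_isog ->; rewrite card_Zp; [left | | right |].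
have := generating_hypothesis_card_le3 p_prime pG char_k GH.
have isoZ n : prime n -> #|[set: gT]| = n -> [set: gT] \isog Zp n.
  move=> n_pr cG.
  have /cyclicP[y Gy] : cyclic [set: gT] by rewrite prime_cyclic ?cG.
  have <- : #[y]%g = n by rewrite orderE -Gy.
  by rewrite Gy isog_sym; apply: Zp_isog.
case cG: #|_| => [|[|[|[|]]]] // _.
- by move: (cardG_gt0 [set: gT]%G); rewrite /= cG.
- by case: ntG; apply: card1_trivg; rewrite -cG.
- by left; apply: isoZ.
- by right; apply: isoZ.
Qed.
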